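(* Let $H$ be a Hopf $\pi$-coalgebra and let $M=\{M_\alpha\}_{\alpha\in\pi}$ be a right Hopf $\pi$-comodule over $H$. Let $M^{\mathrm{co}H}$ be the $\pi$-subcomodule of coinvariants of $M$ and let $M^{\mathrm{co}H}\otimes H$ be the associated trivial right Hopf $\pi$-comodule. Then there exists an isomorphism of Hopf $\pi$-comodules $M\cong M^{\mathrm{co}H}\otimes H$.
   Context: Throughout, $\pi$ is a discrete group with neutral element $1$, $\Bbbk$ is a field, $\otimes=\otimes_\Bbbk$, and algebras are associative and unital over $\Bbbk$ (the zero algebra is allowed). A $\pi$-coalgebra is a family $C=\{C_\alpha\}_{\alpha\in\pi}$ of $\Bbbk$-spaces with $\Bbbk$-linear maps $\Delta_{\alpha,\beta}:C_{\alpha\beta}\to C_\alpha\otimes C_\beta$ and $\epsilon:C_1\to\Bbbk$ such that $(\Delta_{\alpha,\beta}\otimes\mathrm{id}_{C_\gamma})\Delta_{\alpha\beta,\gamma}=(\mathrm{id}_{C_\alpha}\otimes\Delta_{\beta,\gamma})\Delta_{\alpha,\beta\gamma}$ and $(\mathrm{id}_{C_\alpha}\otimes\epsilon)\Delta_{\alpha,1}=\mathrm{id}_{C_\alpha}=(\epsilon\otimes\mathrm{id}_{C_\alpha})\Delta_{1,\alpha}$ for all $\alpha,\beta,\gamma\in\pi$. A Hopf $\pi$-coalgebra is a $\pi$-coalgebra $H=(\{H_\alpha\},\Delta,\epsilon)$ with $\Bbbk$-linear maps $S_\alpha:H_\alpha\to H_{\alpha^{-1}}$ such that each $H_\alpha$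 is an algebra with multiplication $m_\alpha$ and unit $1_\alpha$, the maps $\epsilon$ and all $\Delta_{\alpha,\beta}$ are algebra homomorphisms, and $m_\alpha(S_{\alpha^{-1}}\otimes\mathrm{id}_{H_\alpha})\Delta_{\alpha^{-1},\alpha}=\epsilon 1_\alpha=m_\alpha(\mathrm{id}_{H_\alpha}\otimes S_{\alpha^{-1}})\Delta_{\alpha,\alpha^{-1}}$ for all $\alpha$. A right $\pi$-comodule over $H$ is a family $M=\{M_\alpha\}_{\alpha\in\pi}$ of $\Bbbk$-spaces with linear maps $\rho_{\alpha,\beta}:M_{\alpha\beta}\to M_\alpha\otimes H_\beta$ such that $(\rho_{\alpha,\beta}\otimes\mathrm{id}_{H_\gamma})\rho_{\alpha\beta,\gamma}=(\mathrm{id}_{M_\alpha}\otimes\Delta_{\beta,\gamma})\rho_{\alpha,\beta\gamma}$ and $(\mathrm{id}_{M_\alpha}\otimes\epsilon)\rho_{\alpha,1}=\mathrm{id}_{M_\alpha}$. A $\pi$-subcomodule is a family of subspaces $N_\alpha\subset M_\alpha$ with $\rho_{\alpha,\beta}(N_{\alpha\beta})\subset N_\alpha\otimes H_\beta$. A $\pi$-comodule morphism $M\to M'$ is a family of linear maps $f_\alpha:M_\alpha\to M'_\alpha$ with $\rho'_{\alpha,\beta}f_{\alpha\beta}=(f_\alpha\otimes\mathrm{id}_{H_\beta})\rho_{\alpha,\beta}$. A right Hopf $\pi$-comodule over $H$ is a right $\pi$-comodule $M$ such that each $M_\alpha$ is a right $H_\alpha$-module and, for all $\alpha,\beta\in\pi$,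 $m\in M_{\alpha\beta}$, $a\in H_{\alpha\beta}$, $\rho_{\alpha,\beta}(m\cdot a)=\rho_{\alpha,\beta}(m)\cdot\Delta_{\alpha,\beta}(a)$, where $M_\alpha\otimes H_\beta$ is a right $H_\alpha\otimes H_\beta$-module factorwise ($H_\beta$ acting on itself by right multiplication). A Hopf $\pi$-comodule morphism is a $\pi$-comodule morphism $f=\{f_\alpha\}$ with each $f_\alpha$ being $H_\alpha$-linear. Coinvariants: $M^{\mathrm{co}H}_\alpha$ is the image under the projection to $M_\alpha$ of the space $\{(m_\gamma)_{\gamma\in\pi}\in\prod_{\gamma\in\pi}M_\gamma \mid \rho_{\gamma,\delta}(m_{\gamma\delta})=m_\gamma\otimes1_\delta \text{ for all }\gamma,\delta\in\pi\}$; $M^{\mathrm{co}H}=\{M^{\mathrm{co}H}_\alpha\}_{\alpha\in\pi}$ is a $\pi$-subcomodule of $M$. Trivial Hopf $\pi$-comodule: for a right $\pi$-comodule $N$ over $H$ with structure maps $\rho$, $N\otimes H=\{N_\alpha\otimes H_\alpha\}_{\alpha\in\pi}$ with action $(n\otimes h)\cdot a=n\otimes ha$ and structure maps $\xi_{\alpha,\beta}(n\otimes h)=\sum n_{(0,\alpha)}\otimes h_{(1,\alpha)}\otimes n_{(1,\beta)}h_{(2,\beta)}$, where $\rho_{\alpha,\beta}(n)=\sum n_{(0,\alpha)}\otimes n_{(1,\beta)}$ and $\Delta_{\alpha,\beta}(h)=\sum h_{(1,\alpha)}\otimes h_{(2,\beta)}$. *)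

(* Defs.v *)
From HB Require Import structures.
From mathcomp Require Import all_boot all_algebra.
From mathcomp Require Import boolp classical_sets.

Set Implicit Arguments.
Unset Strict Implicit.
Unset Printing Implicit Defensive.

Import GRing.Theory.
Local Open Scope ring_scope.
Local Open Scope quotient_scope.

Section TensorProduct.
Variables (K : fieldType) (V W : lmodType K).

(* A word [:: (v1, w1); ..; (vn, wn)] stands for the formal sum of the symbols
   vi (x) wi; scalars are carried by the entries. *)
Inductive tens_eq : seq (V * W) -> seq (V * W) -> Prop :=
| tens_eq_refl s : tens_eq s s
| tens_eq_sym s t : tens_eq s t -> tens_eq t s
| tens_eq_trans s t r : tens_eq s t -> tens_eq t r -> tens_eq s r
| tens_eq_cat s s' t t' :
    tens_eq s s' -> tens_eq t t' -> tens_eq (s ++ t) (s' ++ t')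
| tens_eq_catC s t : tens_eq (s ++ t) (t ++ s)
| tens_eq_addl v v' w : tens_eq [:: (v + v', w)] [:: (v, w); (v', w)]
| tens_eq_addr v w w' : tens_eq [:: (v, w + w')] [:: (v, w); (v, w')]
| tens_eq_scale a v w : tens_eq [:: (a *: v, w)] [:: (v, a *: w)]
| tens_eq_zero w : tens_eq [:: (0, w)] [::].

Definition tens_rel : rel (seq (V * W)) := fun s t => `[< tens_eq s t >].

Lemma tens_rel_refl : reflexive tens_rel.
Proof. by move=> s; apply/asboolP; exact: tens_eq_refl. Qed.

Lemma tens_rel_sym : symmetric tens_rel.
Proof.
by move=> s t; apply/asboolP/asboolP; exact: tens_eq_sym.
Qed.

Lemma tens_rel_trans : transitive tens_rel.
Proof.
by move=> t s r /asboolP st /asboolP tr; apply/asboolP; exact: tens_eq_trans tr.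
Qed.

Canonical tens_equiv := EquivRel tens_rel tens_rel_refl tens_rel_sym tens_rel_trans.

(* Universal property: tmk is bilinear (tmk_bilinear), every bilinear map factors
   through tmk (tliftE, tlift_linear), uniquely (tens_ext). *)
Definition tens : Type := {eq_quot tens_equiv}.

HB.instance Definition _ : EqQuotient _ tens_equiv tens :=
  EqQuotient.on tens.
HB.instance Definition _ := Choice.on tens.

Implicit Types (s t : seq (V * W)) (x y z : tens).

Lemma tens_quotW (P : tens -> Prop) :
  (forall s, P (\pi_tens s)) -> forall x, P x.
Proof. by move=> Ppi x; rewrite -[x]reprK. Qed.

Lemma tens_pi s t : tens_eq s t -> \pi_tens s = \pi_tens t.
Proof. by move=> st; apply/eqmodP/asboolP. Qed.

Lemma tens_piE s t : \pi_tens s = \pi_tens t -> tens_eq s t.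
Proof. by move/eqmodP/asboolP. Qed.

Lemma tens_repr s : tens_eq (repr (\pi_tens s)) s.
Proof. by apply: tens_piE; rewrite reprK. Qed.

Definition tens_zero : tens := \pi_tens [::].
Definition tens_add x y : tens := \pi_tens (repr x ++ repr y).
Definition tens_scale (a : K) x : tens :=
  \pi_tens [seq (a *: p.1, p.2) | p <- repr x].

Lemma tens_addE s t :
  tens_add (\pi_tens s) (\pi_tens t) = \pi_tens (s ++ t).
Proof. by apply: tens_pi; apply: tens_eq_cat; exact: tens_repr. Qed.

Lemma tens_scaleE a s :
  tens_scale a (\pi_tens s) = \pi_tens [seq (a *: p.1, p.2) | p <- s].
Proof.
apply: tens_pi; have := tens_repr s; move: (repr _) => t.
elim=> {s t} [s|s t _|s t r _ + _|s s' t t' _ IHs _ IHt|s t|v v' w|v w w'|b v w|w].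
- exact: tens_eq_refl.
- exact: tens_eq_sym.
- exact: tens_eq_trans.
- by rewrite !map_cat; exact: tens_eq_cat.
- by rewrite !map_cat; exact: tens_eq_catC.
- by rewrite /= scalerDr; exact: tens_eq_addl.
- exact: tens_eq_addr.
- by rewrite /= scalerA mulrC -scalerA; exact: tens_eq_scale.
- by rewrite /= scaler0; exact: tens_eq_zero.
Qed.

Lemma tens_addA : associative tens_add.
Proof.
move=> x y z; elim/tens_quotW: x => s; elim/tens_quotW: y => t; elim/tens_quotW: z => r.
by rewrite !tens_addE catA.
Qed.

Lemma tens_addC : commutative tens_add.
Proof.
move=> x y; elim/tens_quotW: x => s; elim/tens_quotW: y => t; rewrite !tens_addE.
exact/tens_pi/tens_eq_catC.
Qed.

Lemma tens_add0 : left_id tens_zero tens_add.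
Proof. by move=> x; elim/tens_quotW: x => s; rewrite tens_addE. Qed.

Lemma tens_scaleA a b x :
  tens_scale a (tens_scale b x) = tens_scale (a * b) x.
Proof.
elim/tens_quotW: x => s; rewrite !tens_scaleE -map_comp; congr (\pi _).
by apply: eq_map => p /=; rewrite scalerA.
Qed.

Lemma tens_scale1 : left_id 1 tens_scale.
Proof.
move=> x; elim/tens_quotW: x => s; rewrite tens_scaleE; congr (\pi _).
by rewrite -[RHS]map_id; apply: eq_map => -[v w] /=; rewrite scale1r.
Qed.

Lemma tens_scaleDr : right_distributive tens_scale tens_add.
Proof.
move=> a x y; elim/tens_quotW: x => s; elim/tens_quotW: y => t.
by rewrite tens_addE !tens_scaleE tens_addE map_cat.
Qed.

Lemma tens_scaleDl x : {morph tens_scale^~ x : a b / a + b >-> tens_add a b}.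
Proof.
move=> a b; elim/tens_quotW: x => s; rewrite !tens_scaleE tens_addE.
apply: tens_pi; elim: s => [|[v w] s IHs] /=; first exact: tens_eq_refl.
rewrite scalerDl.
set s1 := map _ s; set sa := map _ s in IHs *; set sb := map _ s in IHs *.
apply: (@tens_eq_trans _ ([:: (a *: v, w); (b *: v, w)] ++ (sa ++ sb))).
  exact: (tens_eq_cat (tens_eq_addl _ _ _) IHs).
have h t : tens_eq ([:: (b *: v, w)] ++ (sa ++ sb)) (sa ++ ([:: (b *: v, w)] ++ sb)).
  by rewrite !catA; apply: tens_eq_cat (tens_eq_catC _ _) (tens_eq_refl _).
exact: (@tens_eq_cat [:: (a *: v, w)] _ _ _ (tens_eq_refl _) (h s)).
Qed.

Lemma tens_scale0 x : tens_scale 0 x = tens_zero.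
Proof.
elim/tens_quotW: x => s; rewrite tens_scaleE; apply: tens_pi.
elim: s => [|[v w] s IHs] /=; first exact: tens_eq_refl.
rewrite scale0r; exact: (tens_eq_cat (tens_eq_zero w) IHs).
Qed.

Definition tens_opp := tens_scale (-1).

Lemma tens_addN : left_inverse tens_zero tens_opp tens_add.
Proof.
move=> x; rewrite -[X in tens_add _ X]tens_scale1 -tens_scaleDl.
by rewrite addNr tens_scale0.
Qed.

HB.instance Definition _ := GRing.isZmodule.Build tens
  tens_addA tens_addC tens_add0 tens_addN.
HB.instance Definition _ := GRing.Zmodule_isLmodule.Build K tens
  tens_scaleA tens_scale1 tens_scaleDr tens_scaleDl.

Definition tmk (v : V) (w : W) : tens := \pi_tens [:: (v, w)].


Local Notation "v ⊗ w" := (tmk v w) (at level 40, left associativity).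

Lemma tmkDl v v' w : (v + v') ⊗ w = v ⊗ w + v' ⊗ w.
Proof. by rewrite [RHS]tens_addE; exact/tens_pi/tens_eq_addl. Qed.

Lemma tmkDr v w w' : v ⊗ (w + w') = v ⊗ w + v ⊗ w'.
Proof. by rewrite [RHS]tens_addE; exact/tens_pi/tens_eq_addr. Qed.

Lemma tmkZl a v w : (a *: v) ⊗ w = a *: (v ⊗ w).
Proof. by rewrite [RHS]tens_scaleE. Qed.

Lemma tmkZr a v w : v ⊗ (a *: w) = a *: (v ⊗ w).
Proof.
by rewrite -tmkZl; apply: tens_pi; apply: tens_eq_sym; exact: tens_eq_scale.
Qed.

Lemma tmk_bilinear : bilinear_for *:%R *:%R tmk.
Proof.
split=> [w|v] a x y; first by rewrite tmkDl tmkZl.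
by rewrite tmkDr tmkZr.
Qed.

HB.instance Definition _ := bilinear_isBilinear.Build K V W tens *:%R *:%R tmk
  tmk_bilinear.

Lemma tens_sumE s : \pi_tens s = \sum_(p <- s) p.1 ⊗ p.2.
Proof.
elim: s => [|[v w] s IHs]; first by rewrite big_nil.
by rewrite big_cons -IHs /= [RHS]tens_addE.
Qed.

Lemma tens_ind (P : tens -> Prop) :
    P 0 -> (forall x y, P x -> P y -> P (x + y)) -> (forall v w, P (v ⊗ w)) ->
  forall x, P x.
Proof.
move=> P0 PD Pmk; apply: tens_quotW => s; rewrite tens_sumE.
elim: s => [|p s IHs]; first by rewrite big_nil.
by rewrite big_cons; apply: PD => //; exact: Pmk.
Qed.

Lemma tens_ext (U : lmodType K) (f g : tens -> U) :
    linear f -> linear g -> (forall v w, f (v ⊗ w) = g (v ⊗ w)) -> f =1 g.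
Proof.
move=> linf ling fg.
have D (h : tens -> U) (linh : linear h) x y : h (x + y) = h x + h y.
  by have := linh 1 x y; rewrite !scale1r.
have Z (h : tens -> U) (linh : linear h) : h 0 = 0.
  by apply: (addIr (h 0)); rewrite -D // !add0r.
apply: tens_ind => [|x y fgx fgy|//]; first by rewrite !Z.
by rewrite !D // fgx fgy.
Qed.

Section Lift.
Variable U : lmodType K.

(* Well defined on classes, hence meaningful, only for bilinear f: see tliftE
   and tlift_linear. *)
Definition tlift (f : V -> W -> U) x : U := \sum_(p <- repr x) f p.1 p.2.

Variable f : V -> W -> U.
Hypothesis bif : bilinear_for *:%R *:%R f.

Let fPl a v v' w : f (a *: v + v') w = a *: f v w + f v' w.
Proof. exact: bif.1. Qed.
Let fPr a v w w' : f v (a *: w + w') = a *: f v w + f v w'.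
Proof. exact: bif.2. Qed.
Let fDl v v' w : f (v + v') w = f v w + f v' w.
Proof. by have := fPl 1 v v' w; rewrite !scale1r. Qed.
Let fDr v w w' : f v (w + w') = f v w + f v w'.
Proof. by have := fPr 1 v w w'; rewrite !scale1r. Qed.
Let f0l w : f 0 w = 0.
Proof. by apply: (addIr (f 0 w)); rewrite -fDl !add0r. Qed.
Let f0r v : f v 0 = 0.
Proof. by apply: (addIr (f v 0)); rewrite -fDr !add0r. Qed.
Let fZl a v w : f (a *: v) w = a *: f v w.
Proof. by have := fPl a v 0 w; rewrite !addr0 f0l addr0. Qed.
Let fZr a v w : f v (a *: w) = a *: f v w.
Proof. by have := fPr a v w 0; rewrite !addr0 f0r addr0. Qed.

Lemma tlift_pi s : tlift f (\pi_tens s) = \sum_(p <- s) f p.1 p.2.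
Proof.
rewrite /tlift; have := tens_repr s; move: (repr _) => t.
elim=> {s t} [s|s t _|s t r _ + _|s s' t t' _ IHs _ IHt|s t|v v' w|v w w'|b v w|w].
- by [].
- by move->.
- by move-> => ->.
- by rewrite !big_cat IHs IHt.
- by rewrite !big_cat /= addrC.
- by rewrite !big_cons !big_nil !addr0 fDl.
- by rewrite !big_cons !big_nil !addr0 fDr.
- by rewrite !big_cons !big_nil !addr0 fZl fZr.
- by rewrite big_cons !big_nil addr0 f0l.
Qed.

Lemma tliftE v w : tlift f (v ⊗ w) = f v w.
Proof. by rewrite tlift_pi big_cons big_nil addr0. Qed.

Lemma tlift_linear : linear (tlift f).
Proof.
move=> a; apply: tens_quotW => s; apply: tens_quotW => t.
rewrite [_ *: _]tens_scaleE [_ + _]tens_addE !tlift_pi big_cat /= big_map.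
by rewrite scaler_sumr; congr (_ + _); apply: eq_bigr => p _; rewrite fZl.
Qed.

End Lift.

Lemma bilinear_map_for (U : lmodType K) (f : {bilinear V -> W -> U}) :
  bilinear_for *:%R *:%R f.
Proof.
by split=> [w|v] a x y; rewrite ?linearPl ?linearP.
Qed.

HB.instance Definition _ (U : lmodType K) (f : {bilinear V -> W -> U}) :=
  GRing.isLinear.Build K tens U *:%R (tlift f)
    (tlift_linear (bilinear_map_for f)).

Lemma tliftbE (U : lmodType K) (f : {bilinear V -> W -> U}) v w :
  tlift f (v ⊗ w) = f v w.
Proof. exact: tliftE (bilinear_map_for f) _ _. Qed.

End TensorProduct.

Notation "v ⊗ w" := (tmk v w) (at level 40, left associativity) : ring_scope.

Section TensorMap.
Variables (K : fieldType) (V V' W W' : lmodType K).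

Definition tmap (f : V -> W) (g : V' -> W') : tens V V' -> tens W W' :=
  tlift (fun v v' => f v ⊗ g v').

Section Linear.
Variables (f : {linear V -> W}) (g : {linear V' -> W'}).

Let bi : bilinear_for *:%R *:%R (fun v v' => f v ⊗ g v').
Proof. by split=> [v'|v] a x y /=; rewrite linearP (linearPl, linearPr). Qed.

HB.instance Definition _ := GRing.isLinear.Build K _ _ _ (tmap f g)
  (tlift_linear bi).

Lemma tmapE v v' : tmap f g (v ⊗ v') = f v ⊗ g v'.
Proof. exact: tliftE bi _ _. Qed.

End Linear.
End TensorMap.

Section TensorMap2.
Variables (K : fieldType) (U V W U' V' W' : lmodType K).

(* (u ⊗ u', v ⊗ v') |-> f u v ⊗ g u' v' *)
Definition tmap2 (f : U -> V -> W) (g : U' -> V' -> W')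
    (x : tens U U') (y : tens V V') : tens W W' :=
  tlift (fun u u' => tmap (f u) (g u') y) x.

Section Bilinear.
Variables (f : {bilinear U -> V -> W}) (g : {bilinear U' -> V' -> W'}).

Let bi y : bilinear_for *:%R *:%R (fun u u' => tmap (f u) (g u') y).
Proof.
split=> [u' a u1 u2|u a u1 u2].
  move: y; apply: tens_ext => [b x y|b x y|v v'].
  - by rewrite linearP.
  - rewrite !linearP /= !scalerDr !scalerA (mulrC a b) -!addrA.
    by congr (_ + _); rewrite addrCA.
  - by rewrite !tmapE /= !linearPl.
move: y; apply: tens_ext => [b x y|b x y|v v'].
- by rewrite linearP.
- rewrite !linearP /= !scalerDr !scalerA (mulrC a b) -!addrA.
  by congr (_ + _); rewrite addrCA.
- by rewrite !tmapE /= linearPl linearPr.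
Qed.

Lemma tmap2E u u' v v' :
  tmap2 f g (u ⊗ u') (v ⊗ v') = f u v ⊗ g u' v'.
Proof. by rewrite /tmap2 (tliftE (bi _)) tmapE. Qed.

Lemma tmap2_bilinear : bilinear_for *:%R *:%R (tmap2 f g).
Proof.
split=> [y|x a y1 y2]; first exact: tlift_linear (bi y).
move: x; apply: tens_ext => [||u u'].
- exact: tlift_linear.
- move=> b x x'; rewrite /tmap2 !(tlift_linear (bi _)) /= !scalerDr !scalerA.
  by rewrite (mulrC a b) -!addrA; congr (_ + _); rewrite addrCA.
- by rewrite /tmap2 !(tliftE (bi _)) linearP.
Qed.

HB.instance Definition _ := bilinear_isBilinear.Build K _ _ _ *:%R *:%R
  (tmap2 f g) tmap2_bilinear.

End Bilinear.
End TensorMap2.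

Section TensorUnits.
Variables (K : fieldType).

Section Assoc.
Variables (U V W : lmodType K).

Definition tassoc : tens (tens U V) W -> tens U (tens V W) :=
  tlift (fun x w => tlift (fun u v => u ⊗ (v ⊗ w)) x).

Let bi1 (w : W) : bilinear_for *:%R *:%R (fun (u : U) (v : V) => u ⊗ (v ⊗ w)).
Proof.
split=> [v|u] a x y /=; first by rewrite linearPl.
by rewrite linearPl linearPr.
Qed.

Let bi2 : bilinear_for *:%R *:%R
  (fun (x : tens U V) (w : W) => tlift (fun u v => u ⊗ (v ⊗ w)) x).
Proof.
split=> [w|x] a; first exact: tlift_linear.
move=> w w'; move: x; apply: tens_ext => [||u v].
- exact: tlift_linear.
- move=> b x x'; rewrite !(tlift_linear (bi1 _)) /= !scalerDr !scalerA.
  by rewrite (mulrC a b) -!addrA; congr (_ + _); rewrite addrCA.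
- by rewrite !(tliftE (bi1 _)) !linearPr.
Qed.

HB.instance Definition _ := GRing.isLinear.Build K
  (tens (tens U V) W) (tens U (tens V W)) *:%R tassoc
  (tlift_linear bi2).

Lemma tassocE u v w : tassoc (u ⊗ v ⊗ w) = u ⊗ (v ⊗ w).
Proof. by rewrite /tassoc (tliftE bi2) (tliftE (bi1 _)). Qed.

End Assoc.

Section Unit.
Variable V : lmodType K.

(* v ⊗ a |-> a v and a ⊗ v |-> a v *)
Definition tunitr : tens V K^o -> V := tlift (fun v (a : K^o) => (a : K) *: v).
Definition tunitl : tens K^o V -> V := tlift (fun (a : K^o) v => (a : K) *: v).

Let bir : bilinear_for *:%R *:%R (fun (v : V) (a : K^o) => (a : K) *: v).
Proof.
split=> [b|v] a x y /=; first by rewrite scalerDr !scalerA mulrC.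
by rewrite scalerDl scalerA.
Qed.

Let bil : bilinear_for *:%R *:%R (fun (a : K^o) (v : V) => (a : K) *: v).
Proof. by split=> [v|b] a x y; [exact: bir.2 | exact: bir.1]. Qed.

HB.instance Definition _ := GRing.isLinear.Build K (tens V K^o) V *:%R tunitr
  (tlift_linear bir).
HB.instance Definition _ := GRing.isLinear.Build K (tens K^o V) V *:%R tunitl
  (tlift_linear bil).

Lemma tunitrE v (a : K^o) : tunitr (v ⊗ a) = (a : K) *: v.
Proof. exact: tliftE bir _ _. Qed.
Lemma tunitlE v (a : K^o) : tunitl (a ⊗ v) = (a : K) *: v.
Proof. exact: tliftE bil _ _. Qed.

End Unit.
End TensorUnits.

(* MathComp's algType requires 1 != 0, hence excludes the zero algebra. *)
HB.mixin Record Lmodule_isUnitalAlgebra (K : fieldType) A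
    of GRing.Lmodule K A := {
  amul : A -> A -> A;
  aone : A;
  amul_bilinear : bilinear_for *:%R *:%R amul;
  amulA : associative amul;
  amul1x : left_id aone amul;
  amulx1 : right_id aone amul
}.

#[short(type="unitalAlgType")]
HB.structure Definition UnitalAlgebra (K : fieldType) :=
  {A of GRing.Lmodule K A & Lmodule_isUnitalAlgebra K A}.

Arguments aone {K} s.
Infix "∗" := amul (at level 40, left associativity) : ring_scope.

HB.instance Definition _ (K : fieldType) (A : unitalAlgType K) :=
  bilinear_isBilinear.Build K A A A *:%R *:%R (@amul K A) amul_bilinear.

Section RegularAlgebra.
Variable K : fieldType.

Let regular_mul_bilinear :
  bilinear_for *:%R *:%R (fun x y : K^o => ((x : K) * (y : K) : K^o)).
Proof.
split=> [y|x] a u v /=; first by rewrite mulrDl -mulrA.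
by rewrite mulrDr [LHS]addrC mulrCA addrC.
Qed.

HB.instance Definition _ := Lmodule_isUnitalAlgebra.Build K K^o
  regular_mul_bilinear (@mulrA K) (@mul1r K) (@mulr1 K).

End RegularAlgebra.

Definition algebra_hom (K : fieldType) (A B : unitalAlgType K)
    (f : {linear A -> B}) : Prop :=
  (forall x y, f (x ∗ y) = f x ∗ f y) /\ f (aone A) = aone B.

Section TensorAlgebra.
Variables (K : fieldType) (A B : unitalAlgType K).

Definition tens_mul : tens A B -> tens A B -> tens A B :=
  tmap2 (@amul K A) (@amul K B).
Definition tens_one : tens A B := aone A ⊗ aone B.

Lemma tens_mul_bilinear : bilinear_for *:%R *:%R tens_mul.
Proof. exact: tmap2_bilinear. Qed.

HB.instance Definition _ := bilinear_isBilinear.Build K _ _ _ *:%R *:%R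
  tens_mul tens_mul_bilinear.

Lemma tens_mulE a b a' b' : tens_mul (a ⊗ b) (a' ⊗ b') = (a ∗ a') ⊗ (b ∗ b').
Proof. exact: tmap2E. Qed.

Lemma tens_mulA : associative tens_mul.
Proof.
move=> x y z; elim/tens_ind: x => [|x x' IHx IHx'|a b].
- by rewrite !linear0l.
- by rewrite !linearDl /= IHx IHx'.
elim/tens_ind: y => [|x x' IHx IHx'|a' b'].
- by rewrite !(linear0l, linear0r).
- by rewrite !(linearDl, linearDr) /= IHx IHx'.
elim/tens_ind: z => [|x x' IHx IHx'|a'' b''].
- by rewrite !linear0r.
- by rewrite !linearDr /= IHx IHx'.
by rewrite !tens_mulE !amulA.
Qed.

Lemma tens_mul1x : left_id tens_one tens_mul.
Proof.
move=> x; elim/tens_ind: x => [|x x' IHx IHx'|a b]; first by rewrite linear0r.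
  by rewrite linearDr /= IHx IHx'.
by rewrite tens_mulE !amul1x.
Qed.

Lemma tens_mulx1 : right_id tens_one tens_mul.
Proof.
move=> x; elim/tens_ind: x => [|x x' IHx IHx'|a b]; first by rewrite linear0l.
  by rewrite linearDl /= IHx IHx'.
by rewrite tens_mulE !amulx1.
Qed.

HB.instance Definition _ := Lmodule_isUnitalAlgebra.Build K (tens A B)
  tens_mul_bilinear tens_mulA tens_mul1x tens_mulx1.

Lemma tens_amulE (a a' : A) (b b' : B) :
  (a ⊗ b) ∗ (a' ⊗ b') = (a ∗ a') ⊗ (b ∗ b').
Proof. exact: tens_mulE. Qed.

End TensorAlgebra.

Section Subspace.
Variables (K : fieldType) (V : lmodType K).

Definition subspace (S : submodClosed V) : Type := {x : V | x \in S}.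

Section Instances.
Variable S : submodClosed V.
HB.instance Definition _ := SubChoice.on (subspace S).
HB.instance Definition _ := [SubChoice_isSubLmodule of subspace S by <:].
End Instances.

Definition subspace_val (S : submodClosed V) (x : subspace S) : V := \val x.
Arguments subspace_val : simpl never.

HB.instance Definition _ (S : submodClosed V) :=
  GRing.Linear.copy (@subspace_val S) \val.

Lemma subspace_retract (S : submodClosed V) :
  exists r : {linear V -> subspace S}, cancel (@subspace_val S) r.
Proof.
pose closedC (C : set V) := forall a u v, C u -> C v -> C (a *: u + v).
pose P : set (set V) :=
  fun C => closedC C /\ forall x, C x -> x \in S -> x = 0.
have [F FP Ftot|C [[Ccl CS] Cmax]] := @Zorn_bigcup _ P.
  split=> [a u v [X FX Xu] [Y FY Yv]|x [X FX Xx]]; last exact: (FP _ FX).2.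
  have [XY|YX] := Ftot _ _ FX FY.
    by exists Y => //; apply: (FP _ FY).1 => //; exact: XY.
  by exists X => //; apply: (FP _ FX).1 => //; exact: YX.
have C0 : C 0.
  apply: contrapT => nC0; apply: (Cmax (eq^~ 0)); last first.
    split=> [a u v -> ->|x -> //]; by rewrite scaler0 addr0.
  have C_0 x : ~ C x.
    by move=> Cx; apply: nC0; rewrite -(addNr x) -scaleN1r; exact: Ccl.
  by split=> [x /C_0//|h]; exact: nC0 (h 0 erefl).
have CD u v : C u -> C v -> C (u + v).
  by move=> Cu Cv; rewrite -[u]scale1r; exact: Ccl.
have CZ a u : C u -> C (a *: u) by move=> Cu; rewrite -[_ *: _]addr0; exact: Ccl.
have CN u : C u -> C (- u) by rewrite -scaleN1r; exact: CZ.
have dec v : exists s : subspace S, C (v - val s).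
  apply: contrapT => nv.
  have nCv : ~ C v by move=> Cv; apply: nv; exists 0; rewrite [val _]raddf0 subr0.
  pose D : set V := fun x => exists b, C (x - b *: v).
  apply: (Cmax D); last split.
  - split=> [x Cx|DC]; first by exists 0; rewrite scale0r subr0.
    by apply: nCv; apply: DC; exists 1; rewrite scale1r subrr.
  - move=> a x y [b Cx] [c Cy]; exists (a * b + c).
    rewrite scalerDl -scalerA opprD addrACA -scalerBr; exact: Ccl.
  - move=> x [b Cx] xS; have [b0|b0] := eqVneq b 0.
      by apply: CS => //; move: Cx; rewrite b0 scale0r subr0.
    case: nv; have bxS : b^-1 *: x \in S by exact: rpredZ.
    exists (exist (fun y => is_true (y \in S)) _ bxS) => /=.
    have := CZ (- b^-1) _ Cx.
    by rewrite scalerBr scalerA mulNr mulVf // scaleN1r opprK scaleNr addrC.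
have uniq v (s t : subspace S) : C (v - val s) -> C (v - val t) -> s = t.
  move=> Cs Ct; apply/eqP; rewrite -subr_eq0; apply/eqP; apply: val_inj.
  rewrite [RHS](raddf0 (@subspace_val S)).
  apply: CS; last exact: (proj2_sig (s - t)).
  rewrite [X in C X](raddfB (@subspace_val S)) /=.
  have -> : \val s - \val t = (v - \val t) - (v - \val s).
    by rewrite opprB [RHS]addrC addrA subrK.
  by apply: CD => //; exact: CN.
pose r v : subspace S := projT1 (cid (dec v)).
have rP v : C (v - val (r v)) := projT2 (cid (dec v)).
have rlin : linear r.
  move=> a u v; apply: (uniq (a *: u + v)) => //.
  rewrite [\val _](linearP (@subspace_val S)) /= opprD addrACA -scalerBr; exact: Ccl.
pose rL : {linear V -> subspace S} := HB.pack r (GRing.isLinear.Build K _ _ *:%R r rlin).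
exists rL => s /=; apply: (uniq (val s)) => //.
by rewrite subrr.
Qed.

Lemma tmap_val_inj (W : lmodType K) (S : submodClosed V) :
  injective (tmap (@subspace_val S) (@idfun W)).
Proof.
have [r rK] := subspace_retract S.
apply: (can_inj (g := tmap r idfun)).
apply: tens_ext => [a x y|//|s w]; first by rewrite !linearP.
by rewrite !tmapE rK.
Qed.

End Subspace.

Section Transport.
Variables (I : Type) (K : fieldType) (T : I -> lmodType K).

Definition transport (i j : I) (e : i = j) : T i -> T j :=
  let: erefl := e in idfun.

Lemma transport_linear i j (e : i = j) : linear (transport e).
Proof. by case: j / e. Qed.

HB.instance Definition _ i j (e : i = j) :=
  GRing.isLinear.Build K (T i) (T j) *:%R (transport e) (transport_linear e).

End Transport.

Arguments transport {I K} T {i j} e _.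

Section HopfPicoalgebra.
Variables (K : fieldType) (G : groupType).

(* G is the grading group, written pi in the literature. The identifications
   C_{(ab)c} = C_{a(bc)} and C_{a1} = C_a = C_{1a} are made by transport along
   the group laws, (A ⊗ B) ⊗ C = A ⊗ (B ⊗ C) by tassoc, and A ⊗ K = A = K ⊗ A by
   tunitr and tunitl. *)
Record picoalgebra_axioms (C : G -> lmodType K)
    (comul : forall a b, {linear C (a * b)%g -> tens (C a) (C b)})
    (counit : {linear C 1%g -> K^o}) : Prop := PicoalgebraAxioms {
  comulA : forall a b c (x : C (a * b * c)%g),
    tassoc (tmap (comul a b) idfun (comul (a * b)%g c x)) =
    tmap idfun (comul b c)
      (comul a (b * c)%g (transport C (esym (mulgA a b c)) x));
  comul_counitr : forall a (x : C a),
    tunitr (tmap idfun counit (comul a 1%g (transport C (esym (mulg1 a)) x))) = x;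
  comul_counitl : forall a (x : C a),
    tunitl (tmap counit idfun (comul 1%g a (transport C (esym (mul1g a)) x))) = x
}.

(* In antipodel and antipoder, S_{a^-1} : H_{a^-1} -> H_{(a^-1)^-1} is followed
   by the transport to H_a, and x : H_1 is transported to H_{a^-1 a}, resp.
   H_{a a^-1}. *)
Record hopf_picoalgebra := HopfPicoalgebra {
  hopf_obj :> G -> unitalAlgType K;
  comul : forall a b,
    {linear hopf_obj (a * b)%g -> tens (hopf_obj a) (hopf_obj b)};
  counit : {linear hopf_obj 1%g -> K^o};
  antipode : forall a, {linear hopf_obj a -> hopf_obj a^-1%g};
  hopf_picoalgebraP :
    @picoalgebra_axioms (fun a => hopf_obj a) comul counit;
  comul_hom : forall a b, algebra_hom (comul a b);
  counit_hom : algebra_hom counit;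
  antipodel : forall a (x : hopf_obj 1%g),
    tlift amul
      (tmap (transport (fun a => hopf_obj a) (invgK a) \o antipode a^-1%g) idfun
        (comul a^-1%g a
          (transport (fun a => hopf_obj a) (esym (mulVg a)) x))) =
    (counit x : K) *: aone (hopf_obj a);
  antipoder : forall a (x : hopf_obj 1%g),
    tlift amul
      (tmap idfun (transport (fun a => hopf_obj a) (invgK a) \o antipode a^-1%g)
        (comul a a^-1%g
          (transport (fun a => hopf_obj a) (esym (mulgV a)) x))) =
    (counit x : K) *: aone (hopf_obj a)
}.

End HopfPicoalgebra.

Section HopfPicomodule.
Variables (K : fieldType) (G : groupType) (H : hopf_picoalgebra K G).

Record picomodule := Picomodule {
  comod_obj :> G -> lmodType K;
  coact : forall a b,
    {linear comod_obj (a * b)%g -> tens (comod_obj a) (H b)};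
  coactA : forall a b c (m : comod_obj (a * b * c)%g),
    tassoc (tmap (coact a b) idfun (coact (a * b)%g c m)) =
    tmap idfun (comul H b c)
      (coact a (b * c)%g (transport comod_obj (esym (mulgA a b c)) m));
  coact_counit : forall a (m : comod_obj a),
    tunitr (tmap idfun (counit H)
      (coact a 1%g (transport comod_obj (esym (mulg1 a)) m))) = m
}.

Record hopf_picomodule := HopfPicomodule {
  hopf_comod :> picomodule;
  ract : forall a, {bilinear hopf_comod a -> H a -> hopf_comod a};
  ractM : forall a m (x y : H a), ract a m (x ∗ y) = ract a (ract a m x) y;
  ract1 : forall a m, ract a m (aone (H a)) = m;
  coact_ract : forall a b (m : hopf_comod (a * b)%g) (x : H (a * b)%g),
    coact hopf_comod a b (ract (a * b)%g m x) =
    tmap2 (ract a) (@amul K (H b)) (coact hopf_comod a b m) (comul H a b x)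
}.

Definition picomodule_hom (M N : picomodule)
    (f : forall a, {linear M a -> N a}) : Prop :=
  forall a b (m : M (a * b)%g),
    coact N a b (f (a * b)%g m) = tmap (f a) idfun (coact M a b m).

Definition hopf_picomodule_hom (M N : hopf_picomodule)
    (f : forall a, {linear M a -> N a}) : Prop :=
  picomodule_hom f /\
  forall a m (x : H a), f a (ract M a m x) = ract N a (f a m) x.

Definition hopf_picomodule_iso (M N : hopf_picomodule) : Prop :=
  exists (f : forall a, {linear M a -> N a})
         (g : forall a, {linear N a -> M a}),
    [/\ hopf_picomodule_hom f, hopf_picomodule_hom g,
        forall a, cancel (f a) (g a) & forall a, cancel (g a) (f a)].

Record subpicomodule (M : picomodule) := Subpicomodule {
  sub_obj :> forall a, submodClosed (M a);
  sub_coact_stable : forall a b (x : subspace (sub_obj (a * b)%g)),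
    exists t : tens (subspace (sub_obj a)) (H b),
      tmap (@subspace_val _ _ (sub_obj a)) idfun t =
      coact M a b (subspace_val x)
}.

Section SubPicomodule.
Variables (M : picomodule) (N : subpicomodule M).

(* The restriction of coact M; the chosen preimage is the only one, by
   tmap_val_inj. *)
Definition sub_coact a b (x : subspace (N (a * b)%g)) :
    tens (subspace (N a)) (H b) :=
  projT1 (cid (sub_coact_stable x)).

Lemma sub_coactE a b x :
  tmap (@subspace_val _ _ (N a)) idfun (@sub_coact a b x) =
  coact M a b (subspace_val x).
Proof. exact: (projT2 (cid (sub_coact_stable x))). Qed.

Lemma sub_coact_linear a b : linear (@sub_coact a b).
Proof.
move=> k x y; apply: tmap_val_inj.
by rewrite sub_coactE [RHS]linearP /= !sub_coactE !linearP.
Qed.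

HB.instance Definition _ a b :=
  GRing.isLinear.Build K _ _ *:%R (@sub_coact a b) (@sub_coact_linear a b).

Lemma transport_val a b (e : a = b) (x : subspace (N a)) :
  subspace_val (transport (fun a => subspace (N a)) e x) =
  transport M e (subspace_val x).
Proof. by case: b / e. Qed.

Lemma sub_coactA a b c (x : subspace (N (a * b * c)%g)) :
  tassoc (tmap (@sub_coact a b) idfun (@sub_coact (a * b)%g c x)) =
  tmap idfun (comul H b c)
    (@sub_coact a (b * c)%g
      (transport (fun a => subspace (N a)) (esym (mulgA a b c)) x)).
Proof.
apply: tmap_val_inj.
have e1 (t : tens (subspace (N (a * b)%g)) (H c)) :
    tmap (@subspace_val _ _ (N a)) idfun
      (tassoc (tmap (@sub_coact a b) idfun t)) =
    tassoc (tmap (coact M a b) idfun (tmap (@subspace_val _ _ _) idfun t)).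
  elim/tens_ind: t => [|t t' IHt IHt'|n h]; first by rewrite !raddf0.
    by rewrite !raddfD /= IHt IHt'.
  rewrite !tmapE /= -sub_coactE; elim/tens_ind: (sub_coact _).
  - by rewrite !(raddf0, linear0l).
  - by move=> t t' IHt IHt'; rewrite !(raddfD, linearDl) /= IHt IHt'.
  - by move=> s h'; rewrite tmapE !tassocE tmapE.
have e2 (t : tens (subspace (N a)) (H (b * c)%g)) :
    tmap (@subspace_val _ _ (N a)) idfun (tmap idfun (comul H b c) t) =
    tmap idfun (comul H b c) (tmap (@subspace_val _ _ _) idfun t).
  elim/tens_ind: t => [|t t' IHt IHt'|n h]; first by rewrite !raddf0.
    by rewrite !raddfD /= IHt IHt'.
  by rewrite !tmapE.
by rewrite e1 e2 !sub_coactE transport_val coactA.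
Qed.

Lemma sub_coact_counit a (x : subspace (N a)) :
  tunitr (tmap idfun (counit H)
    (@sub_coact a 1%g
      (transport (fun a => subspace (N a)) (esym (mulg1 a)) x))) = x.
Proof.
apply: val_inj; rewrite -[LHS]/(subspace_val _) -[RHS](coact_counit (p := M)).
rewrite -[in RHS]transport_val -sub_coactE; elim/tens_ind: (sub_coact _).
- by rewrite !raddf0.
- by move=> t t' IHt IHt'; rewrite !raddfD /= IHt IHt'.
- by move=> n h; rewrite !tmapE !tunitrE linearZ.
Qed.

Definition subpicomodule_picomodule : picomodule :=
  @Picomodule (fun a => subspace (N a)) (fun a b => @sub_coact a b)
    sub_coactA sub_coact_counit.

End SubPicomodule.

Section Coinvariants.
Variable M : picomodule.

Definition coinvariant_family (m : forall a, M a) : Prop :=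
  forall a b, coact M a b (m (a * b)%g) = m a ⊗ aone (H b).

Definition coinv_set a : {pred M a} :=
  fun x => `[< exists2 m : forall c, M c, coinvariant_family m & m a = x >].

Lemma coinv_submod a : subsemimod_closed (@coinv_set a).
Proof.
split; [split|].
- apply/asboolP; exists (fun=> 0) => // b c.
  by rewrite raddf0 linear0l.
- move=> _ _ /asboolP[m mP <-] /asboolP[n nP <-]; apply/asboolP.
  exists (fun c => m c + n c) => // b c.
  by rewrite raddfD linearDl /= mP nP.
- move=> k _ /asboolP[m mP <-]; apply/asboolP.
  exists (fun c => k *: m c) => // b c.
  by rewrite linearZ /= mP linearZl_LR.
Qed.

HB.instance Definition _ a :=
  GRing.isSubmodClosed.Build K (M a) (@coinv_set a) (@coinv_submod a).

Lemma coinv_stable a b (x : subspace (@coinv_set (a * b)%g)) :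
  exists t : tens (subspace (@coinv_set a)) (H b),
    tmap (@subspace_val _ _ _) idfun t = coact M a b (subspace_val x).
Proof.
case: x => x /= xP; have /asboolP[m mP mx] := xP.
have maP : m a \in @coinv_set a by apply/asboolP; exists m.
exists ((exist (fun y => is_true (y \in @coinv_set a)) _ maP : subspace _)
  ⊗ aone (H b)).
by rewrite tmapE -[RHS]/(coact M a b x) -mx mP.
Qed.

Definition coinvariants : subpicomodule M :=
  @Subpicomodule M (fun a => @coinv_set a) coinv_stable.

End Coinvariants.

Section TrivialHopfPicomodule.
Variable N : picomodule.

Definition triv_obj a : lmodType K := tens (N a) (H a).

(* n ⊗ h |-> sum (n_(0) ⊗ h_(1)) ⊗ n_(1) h_(2) *)
Definition triv_coact a b :
    triv_obj (a * b)%g -> tens (triv_obj a) (H b) :=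
  tlift (fun n h =>
    tmap2 (@tmk K (N a) (H a)) (@amul K (H b)) (coact N a b n) (comul H a b h)).

Definition triv_act a (t : triv_obj a) (x : H a) : triv_obj a :=
  tlift (fun n h => n ⊗ (h ∗ x)) t.

Let biρ a b : bilinear_for *:%R *:%R (fun (n : N (a * b)%g) (h : H (a * b)%g) =>
  tmap2 (@tmk K (N a) (H a)) (@amul K (H b)) (coact N a b n) (comul H a b h)).
Proof. by split=> [h|n] k x y /=; rewrite linearP (linearPl, linearPr). Qed.

HB.instance Definition _ a b := GRing.isLinear.Build K (triv_obj (a * b)%g)
  (tens (triv_obj a) (H b)) *:%R (@triv_coact a b) (tlift_linear (biρ a b)).

Lemma triv_coactE a b n h : @triv_coact a b (n ⊗ h) =
  tmap2 (@tmk K (N a) (H a)) (@amul K (H b)) (coact N a b n) (comul H a b h).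
Proof. exact: tliftE (biρ a b) _ _. Qed.

Let biA a (x : H a) : bilinear_for *:%R *:%R (fun (n : N a) h => n ⊗ (h ∗ x)).
Proof.
split=> [h|n] k y z /=; first by rewrite linearPl.
by rewrite linearPl linearPr.
Qed.

Lemma triv_actE a n (h x : H a) : triv_act (n ⊗ h) x = n ⊗ (h ∗ x).
Proof. exact: tliftE (biA x) _ _. Qed.

Lemma triv_act_bilinear a : bilinear_for *:%R *:%R (@triv_act a).
Proof.
split=> [x|t k x y]; first exact: tlift_linear (biA x).
move: t; apply: tens_ext => [|c t t'|n h].
- exact: tlift_linear.
- rewrite /triv_act !(tlift_linear (biA _)) /= !scalerDr !scalerA.
  by rewrite (mulrC k c) -!addrA; congr (_ + _); rewrite addrCA.
- by rewrite !triv_actE !linearPr.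
Qed.

HB.instance Definition _ a := bilinear_isBilinear.Build K
  (triv_obj a) (H a) (triv_obj a) *:%R *:%R (@triv_act a) (@triv_act_bilinear a).

Lemma transport_triv a b (e : a = b) n h :
  transport triv_obj e (n ⊗ h) =
  transport N e n ⊗ transport (fun a => H a) e h.
Proof. by case: b / e. Qed.

(* Factorwise product N_a ⊗ (H_b ⊗ H_c) x H_a ⊗ (H_b ⊗ H_c)
   -> (N_a ⊗ H_a) ⊗ (H_b ⊗ H_c). *)
Let Θ a b c := tmap2 (@tmk K (N a) (H a)) (@amul K (tens (H b) (H c))).

Let triv_coactAl a b c (s : tens (N (a * b)%g) (H c))
    (t : tens (H (a * b)%g) (H c)) :
  tassoc (tmap (@triv_coact a b) idfun (tmap2 (@tmk _ _ _) (@amul _ _) s t)) =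
  @Θ a b c (tassoc (tmap (coact N a b) idfun s))
           (tassoc (tmap (comul H a b) idfun t)).
Proof.
rewrite /Θ; elim/tens_ind: s => [|s s' IHs IHs'|n k].
- by rewrite !(raddf0, linear0l).
- by rewrite !(raddfD, linearDl) /= IHs IHs'.
elim/tens_ind: t => [|s s' IHs IHs'|h l].
- by rewrite !(raddf0, linear0r).
- by rewrite !(raddfD, linearDr) /= IHs IHs'.
rewrite tmap2E !tmapE /= triv_coactE.
elim/tens_ind: (coact N a b n) => [|s s' IHs IHs'|n0 n1].
- by rewrite !(raddf0, linear0l).
- by rewrite !(raddfD, linearDl) /= IHs IHs'.
elim/tens_ind: (comul H a b h) => [|s s' IHs IHs'|h1 h2].
- by rewrite !(raddf0, linear0l, linear0r).
- by rewrite !(raddfD, linearDl, linearDr) /= IHs IHs'.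
by rewrite tmap2E !tassocE tmap2E /= tens_amulE.
Qed.

Let triv_coactAr a b c (s : tens (N a) (H (b * c)%g))
    (t : tens (H a) (H (b * c)%g)) :
  tmap idfun (comul H b c) (tmap2 (@tmk _ _ _) (@amul _ _) s t) =
  @Θ a b c (tmap idfun (comul H b c) s) (tmap idfun (comul H b c) t).
Proof.
rewrite /Θ; elim/tens_ind: s => [|s s' IHs IHs'|n k].
- by rewrite !(raddf0, linear0l).
- by rewrite !(raddfD, linearDl) /= IHs IHs'.
elim/tens_ind: t => [|s s' IHs IHs'|h l].
- by rewrite !(raddf0, linear0r).
- by rewrite !(raddfD, linearDr) /= IHs IHs'.
by rewrite tmap2E !tmapE tmap2E (comul_hom H b c).1.
Qed.

Lemma triv_coactA a b c (x : triv_obj (a * b * c)%g) :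
  tassoc (tmap (@triv_coact a b) idfun (@triv_coact (a * b)%g c x)) =
  tmap idfun (comul H b c)
    (@triv_coact a (b * c)%g (transport triv_obj (esym (mulgA a b c)) x)).
Proof.
elim/tens_ind: x => [|x x' IHx IHx'|n h]; first by rewrite !raddf0.
  by rewrite !raddfD /= IHx IHx'.
rewrite transport_triv !triv_coactE triv_coactAl triv_coactAr coactA.
by rewrite (comulA (hopf_picoalgebraP H)).
Qed.

Lemma triv_coact_counit a (x : triv_obj a) :
  tunitr (tmap idfun (counit H)
    (@triv_coact a 1%g (transport triv_obj (esym (mulg1 a)) x))) = x.
Proof.
elim/tens_ind: x => [|x x' IHx IHx'|n h]; first by rewrite !raddf0.
  by rewrite !raddfD /= IHx IHx'.
rewrite transport_triv triv_coactE.
rewrite -[in RHS](coact_counit n) -[in RHS](comul_counitr (hopf_picoalgebraP H) h).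
elim/tens_ind: (coact N a 1%g _) => [|s s' IHs IHs'|n0 n1].
- by rewrite !(raddf0, linear0l).
- by rewrite !(raddfD, linearDl) /= IHs IHs'.
elim/tens_ind: (comul H a 1%g _) => [|s s' IHs IHs'|h1 h2].
- by rewrite !(raddf0, linear0r).
- by rewrite !(raddfD, linearDr) /= IHs IHs'.
rewrite tmap2E !tmapE !tunitrE (counit_hom H).1.
by rewrite linearZl_LR linearZr_LR /= scalerA.
Qed.

Definition triv_picomodule : picomodule :=
  @Picomodule triv_obj (fun a b => @triv_coact a b) triv_coactA triv_coact_counit.

Lemma triv_actM a (t : triv_picomodule a) (x y : H a) :
  triv_act t (x ∗ y) = triv_act (triv_act t x) y.
Proof.
elim/tens_ind: t => [|t t' IHt IHt'|n h]; first by rewrite !linear0l.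
  by rewrite !linearDl /= IHt IHt'.
by rewrite !triv_actE amulA.
Qed.

Lemma triv_act1 a (t : triv_picomodule a) : triv_act t (aone (H a)) = t.
Proof.
elim/tens_ind: t => [|t t' IHt IHt'|n h]; first by rewrite !linear0l.
  by rewrite !linearDl /= IHt IHt'.
by rewrite !triv_actE amulx1.
Qed.

Lemma triv_coact_act a b (t : triv_picomodule (a * b)%g) (x : H (a * b)%g) :
  coact triv_picomodule a b (triv_act t x) =
  tmap2 (@triv_act a) (@amul K (H b)) (coact triv_picomodule a b t)
    (comul H a b x).
Proof.
rewrite /=; elim/tens_ind: t => [|t t' IHt IHt'|n h].
- by rewrite !(raddf0, linear0l).
- by rewrite !(raddfD, linearDl) /= IHt IHt'.
rewrite triv_actE !triv_coactE (comul_hom H a b).1.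
elim/tens_ind: (coact N a b n) => [|s s' IHs IHs'|n0 n1].
- by rewrite !linear0l.
- by rewrite !linearDl /= IHs IHs'.
elim/tens_ind: (comul H a b h) => [|s s' IHs IHs'|h1 h2].
- by rewrite !(linear0l, linear0r).
- by rewrite !(linearDl, linearDr) /= IHs IHs'.
elim/tens_ind: (comul H a b x) => [|s s' IHs IHs'|x1 x2].
- by rewrite !linear0r.
- by rewrite !linearDr /= IHs IHs'.
by rewrite tens_amulE !tmap2E /= triv_actE amulA.
Qed.

Definition triv_hopf_picomodule : hopf_picomodule :=
  @HopfPicomodule triv_picomodule (fun a => @triv_act a)
    triv_actM triv_act1 triv_coact_act.

End TrivialHopfPicomodule.
End HopfPicomodule.

(* Main.v *)
(** The projections [P_a m = sum m_(0,a) . S (m_(1,a^-1))] from [M 1] to [M a]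
    play the role of the projection onto the coinvariants in the fundamental
    theorem of Hopf modules, and the isomorphism is
    [m |-> sum P_a (m_(0,1)) (x) m_(1,a)], with inverse [n (x) h |-> n . h].
    For a right [H a]-module [X], convolution with the identity, sending [phi] to
    [m |-> sum phi (m_(0,1)) . m_(1,a)], is a bijection from the linear maps
    [M 1 -> X] to the linear maps [M a -> X]; its inverse is convolution with the
    antipode, and [P_a] corresponds to the identity of [M a].  For
    [X = M a (x) H b], acted on by [H (a * b)] through the comultiplication,
    [coact \o P_(a * b)] and [P_a (x) 1] both correspond to [coact], hence agree:
    the family [P] is coinvariant.  This avoids the anticomultiplicativity of the
    antipode. *)
Require Import Defs.
From HB Require Import structures.
From mathcomp Require Import all_boot all_algebra.
From mathcomp Require Import boolp.

Set Implicit Arguments.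
Unset Strict Implicit.
Unset Printing Implicit Defensive.

Import GRing.Theory.
Local Open Scope ring_scope.

(* Fixes the module structures of A, B and C, which unification does not recover
   from f \o g when they are fibres of a family. *)
Definition lcomp (K : fieldType) (A B C : lmodType K)
    (f : {linear B -> C}) (g : {linear A -> B}) : {linear A -> C} := f \o g.

Definition ltransport (I : Type) (K : fieldType) (T : I -> lmodType K) (i j : I)
  (e : i = j) : {linear T i -> T j} := transport T e.

(** * Structure maps along arbitrary index equations *)

Section ReindexedStructureMaps.
Variables (K : fieldType) (G : groupType) (H : hopf_picoalgebra K G).

(** Taking the index equation as an argument absorbs the transports, so that coassociativity applies
    to every factorization of an index. *)
Definition comul_at a b c (e : (a * b)%g = c) :
    {linear H c -> tens (H a) (H b)} :=
  lcomp (comul H a b) (ltransport (fun a => H a) (esym e)).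

Definition antipodeV a : {linear H a^-1%g -> H a} :=
  lcomp (ltransport (fun a => H a) (invgK a)) (antipode H a^-1%g).

Lemma antipodeV_mull a (x : H 1%g) :
  tlift amul (tmap (antipodeV a) idfun (comul_at (mulVg a) x)) =
  (counit H x : K) *: aone (H a).
Proof. exact: antipodel. Qed.

Lemma antipodeV_mulr a (x : H 1%g) :
  tlift amul (tmap idfun (antipodeV a) (comul_at (mulgV a) x)) =
  (counit H x : K) *: aone (H a).
Proof. exact: antipoder. Qed.

Lemma comul_at_counitl a (x : H a) :
  tunitl (tmap (counit H) idfun (comul_at (mul1g a) x)) = x.
Proof. exact: (comul_counitl (hopf_picoalgebraP H) x). Qed.

Variable M : picomodule H.

Definition coact_at a b c (e : (a * b)%g = c) :
    {linear M c -> tens (M a) (H b)} :=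
  lcomp (coact M a b) (ltransport M (esym e)).

Lemma coact_atA a b c ab bc abc (e1 : (a * b)%g = ab) (e2 : (ab * c)%g = abc)
    (e3 : (b * c)%g = bc) (e4 : (a * bc)%g = abc) (m : M abc) :
  tassoc (tmap (coact_at e1) idfun (coact_at e2 m)) =
  tmap idfun (comul_at e3) (coact_at e4 m).
Proof.
subst ab bc abc.
(* After substitution [e4] is a proof of associativity in [G]. *)
have := coactA m; rewrite (Prop_irrelevance (esym (mulgA a b c)) (esym e4)).
exact.
Qed.

Lemma coact_at_counit a (m : M a) :
  tunitr (tmap idfun (counit H) (coact_at (mulg1 a) m)) = m.
Proof. exact: coact_counit. Qed.

Lemma coinvariant_family_at (m : forall a, M a) a b c (e : (a * b)%g = c) :
  coinvariant_family m -> coact_at e (m c) = m a ⊗ aone (H b).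
Proof. by case: c / e => mP; rewrite -mP. Qed.

End ReindexedStructureMaps.

(** * Convolution with the identity and with the antipode *)

Section Convolution.
Variables (K : fieldType) (G : groupType) (H : hopf_picoalgebra K G).
Variables (M : picomodule H) (a : G) (X : lmodType K).
Variable act : {bilinear X -> H a -> X}.
Hypothesis actM : forall x h k, act x (h ∗ k) = act (act x h) k.
Hypothesis act1 : forall x, act x (aone (H a)) = x.

Definition conv (phi : {linear M 1%g -> X}) : {linear M a -> X} :=
  tlift act \o tmap phi idfun \o coact_at M (mul1g a).

Definition deconv (psi : {linear M a -> X}) : {linear M 1%g -> X} :=
  tlift act \o tmap psi (antipodeV H a) \o coact_at M (mulgV a).

Lemma convE phi m :
  conv phi m = tlift act (tmap phi idfun (coact_at M (mul1g a) m)).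
Proof. by []. Qed.

Lemma deconvE psi m :
  deconv psi m = tlift act (tmap psi (antipodeV H a) (coact_at M (mulgV a) m)).
Proof. by []. Qed.

(** Associativity of convolution, [(f * u) * v = f * (u * v)], with [psi] in the role of [f * u]; it
    comes from [actM]. *)
Lemma tlift_act_tassoc (A B N : lmodType K) c (f : {linear M c -> X})
    (u : {linear A -> H a}) (v : {linear B -> H a}) (psi : {linear N -> X})
    (r : {linear N -> tens (M c) A}) (t : tens N B) :
    (forall n, psi n = tlift act (tmap f u (r n))) ->
  tlift act (tmap psi v t) =
  tlift act (tmap f (tlift amul \o tmap u v) (tassoc (tmap r idfun t))).
Proof.
move=> psiE; elim/tens_ind: t => [|t t' IHt IHt'|n y]; first by rewrite !raddf0.
  by rewrite !raddfD /= IHt IHt'.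
rewrite !tmapE tliftbE psiE.
elim/tens_ind: (r n) => [|t t' IHt IHt'|m x].
- by rewrite !(linear0l, raddf0).
- by rewrite !(linearDl, raddfD) /= IHt IHt'.
by rewrite tassocE !tmapE /= !tmapE !tliftbE /= actM.
Qed.

(** Unit law of convolution: [w \o d] is the counit times the unit of [H a]. *)
Lemma tlift_act_counit c (f : {linear M c -> X}) (B : lmodType K)
    (w : {linear B -> H a}) (d : {linear H 1%g -> B}) (t : tens (M c) (H 1%g)) :
    (forall x, w (d x) = (counit H x : K) *: aone (H a)) ->
  tlift act (tmap f w (tmap idfun d t)) = f (tunitr (tmap idfun (counit H) t)).
Proof.
move=> wdE; elim/tens_ind: t => [|t t' IHt IHt'|m x]; first by rewrite !raddf0.
  by rewrite !raddfD /= IHt IHt'.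
by rewrite !tmapE tliftbE wdE linearZr_LR /= act1 tunitrE linearZ.
Qed.

(** [(phi * id) * S = phi * (id * S) = phi]; [deconvK] uses [S * id] instead. *)
Lemma convK (phi : {linear M 1%g -> X}) : deconv (conv phi) =1 phi.
Proof.
move=> m; rewrite deconvE (tlift_act_tassoc _ _ (convE phi)).
rewrite (coact_atA _ _ (mulgV a) (mulg1 1%g)) tlift_act_counit.
  by rewrite coact_at_counit.
exact: antipodeV_mulr.
Qed.

Lemma deconvK (psi : {linear M a -> X}) : conv (deconv psi) =1 psi.
Proof.
move=> m; rewrite convE (tlift_act_tassoc _ _ (deconvE psi)).
rewrite (coact_atA _ _ (mulVg a) (mulg1 a)) tlift_act_counit.
  by rewrite coact_at_counit.
exact: antipodeV_mull.
Qed.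

End Convolution.

(** Reduces the compatibility of the isomorphism to that of its inverse, which has the simpler
    formula [n . h]. *)
Lemma hopf_picomodule_hom_inv (K : fieldType) (G : groupType)
    (H : hopf_picoalgebra K G) (M N : hopf_picomodule H)
    (f : forall a, {linear M a -> N a}) (g : forall a, {linear N a -> M a}) :
    (forall a, cancel (f a) (g a)) -> (forall a, cancel (g a) (f a)) ->
  hopf_picomodule_hom g -> hopf_picomodule_hom f.
Proof.
move=> fK gK [gcoact gact]; split=> [a b m|a m x]; last first.
  by rewrite -{1}[m]fK -gact gK.
rewrite -{2}[m]fK gcoact; elim/tens_ind: (coact N a b _) => [|t t' IHt IHt'|n h].
- by rewrite !raddf0.
- by rewrite !raddfD /= -IHt -IHt'.
by rewrite !tmapE gK.
Qed.

(** * The projections onto the coinvariants *)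

Section FundamentalTheorem.
Variables (K : fieldType) (G : groupType) (H : hopf_picoalgebra K G).
Variable M : hopf_picomodule H.

Definition coinv_proj a : {linear M 1%g -> M a} :=
  deconv (ract M a) (idfun : {linear M a -> M a}).

Lemma coact_at_ract a b c (e : (a * b)%g = c) (m : M c) (x : H c) :
  coact_at M e (ract M c m x) =
  tmap2 (ract M a) (@amul K (H b)) (coact_at M e m) (comul_at H e x).
Proof. by case: c / e m x => m x; exact: coact_ract. Qed.

Lemma coinv_projK a (m : M a) :
  tlift (ract M a) (tmap (coinv_proj a) idfun (coact_at M (mul1g a) m)) = m.
Proof. exact: (deconvK (@ractM _ _ _ M a) (@ract1 _ _ _ M a)). Qed.

Section TensorModule.
Variables a b : G.

Definition tens_act (t : tens (M a) (H b)) (x : H (a * b)%g) :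
  tens (M a) (H b) := tmap2 (ract M a) (@amul K (H b)) t (comul H a b x).

Lemma tens_act_bilinear : bilinear_for *:%R *:%R tens_act.
Proof.
by split=> [x|t] k y z /=; rewrite /tens_act ?linearPl // linearP linearPr.
Qed.

HB.instance Definition _ :=
  bilinear_isBilinear.Build K _ _ _ *:%R *:%R tens_act tens_act_bilinear.

Lemma tens_actM t x y : tens_act t (x ∗ y) = tens_act (tens_act t x) y.
Proof.
rewrite /tens_act (comul_hom H a b).1.
elim/tens_ind: t => [|t t' IHt IHt'|m h].
- by rewrite !linear0l.
- by rewrite !linearDl /= IHt IHt'.
elim/tens_ind: (comul H a b x) => [|s s' IHs IHs'|x1 x2].
- by rewrite !(linear0l, linear0r).
- by rewrite !(linearDl, linearDr) /= IHs IHs'.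
elim/tens_ind: (comul H a b y) => [|s s' IHs IHs'|y1 y2].
- by rewrite !linear0r.
- by rewrite !linearDr /= IHs IHs'.
by rewrite tens_amulE !tmap2E /= ractM amulA.
Qed.

Lemma tens_act1 t : tens_act t (aone (H (a * b)%g)) = t.
Proof.
rewrite /tens_act (comul_hom H a b).2.
elim/tens_ind: t => [|t t' IHt IHt'|m h]; first by rewrite linear0l.
  by rewrite linearDl /= IHt IHt'.
by rewrite tmap2E /= ract1 amulx1.
Qed.

Definition coinv_proj1 (m : M 1%g) : tens (M a) (H b) :=
  coinv_proj a m ⊗ aone (H b).

Lemma coinv_proj1_linear : linear coinv_proj1.
Proof. by move=> k x y; rewrite /coinv_proj1 linearP linearPl. Qed.

HB.instance Definition _ :=
  GRing.isLinear.Build K _ _ *:%R coinv_proj1 coinv_proj1_linear.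

(** Leaves [y] arbitrary, so that coassociativity can be applied before multiplying. *)
Definition coinv_proj1_mul (m : M 1%g) (y : tens (H a) (H b)) :
  tens (M a) (H b) := tmap2 (ract M a) (@amul K (H b)) (coinv_proj1 m) y.

Lemma coinv_proj1_mul_bilinear : bilinear_for *:%R *:%R coinv_proj1_mul.
Proof.
by split=> [y|m] k u v /=; rewrite /coinv_proj1_mul ?linearPr // linearP linearPl.
Qed.

HB.instance Definition _ := bilinear_isBilinear.Build K _ _ _ *:%R *:%R
  coinv_proj1_mul coinv_proj1_mul_bilinear.

(** By coassociativity, the left side applies the reconstruction [coinv_projK] to the first factor
    of [coact M a b m]. *)
Lemma conv_coinv_proj1 m : conv tens_act coinv_proj1 m = coact M a b m.
Proof.
have comulE t : tlift tens_act (tmap coinv_proj1 idfun t) =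
    tlift coinv_proj1_mul (tmap idfun (comul_at H erefl) t).
  elim/tens_ind: t => [|t t' IHt IHt'|n h]; first by rewrite !raddf0.
    by rewrite !raddfD /= IHt IHt'.
  by rewrite !tmapE !tliftbE.
have assocE t : tlift coinv_proj1_mul (tassoc t) =
    tmap (tlift (ract M a) \o tmap (coinv_proj a) idfun) idfun t.
  elim/tens_ind: t => [|t t' IHt IHt'|t y]; first by rewrite !raddf0.
    by rewrite !raddfD /= IHt IHt'.
  elim/tens_ind: t => [|t t' IHt IHt'|n x].
  - by rewrite !(linear0l, raddf0).
  - by rewrite !(linearDl, raddfD) /= IHt IHt'.
  rewrite tassocE tliftbE tmapE.
  rewrite -[RHS]/(tlift (ract M a) (tmap (coinv_proj a) idfun (n ⊗ x)) ⊗ y).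
  rewrite tmapE tliftbE.
  by rewrite -[y in RHS]amul1x -tmap2E.
rewrite convE comulE -(coact_atA (mul1g a) erefl) assocE.
have -> : coact_at M erefl m = coact M a b m by [].
elim/tens_ind: (coact M a b m) => [|t t' IHt IHt'|n h]; first by rewrite !raddf0.
  by rewrite !raddfD /= IHt IHt'.
by rewrite !tmapE [X in X ⊗ _]coinv_projK.
Qed.

(** Apply [coact] to the reconstruction [coinv_projK] of [m] and use [coact_ract]. *)
Lemma conv_coact_coinv_proj m :
  conv tens_act (lcomp (coact M a b) (coinv_proj (a * b)%g)) m = coact M a b m.
Proof.
rewrite convE -{2}(coinv_projK m).
elim/tens_ind: (coact_at M _ m) => [|t t' IHt IHt'|n h]; first by rewrite !raddf0.
  by rewrite !raddfD /= IHt IHt'.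
by rewrite !tmapE !tliftbE; exact/esym/coact_ract.
Qed.

Lemma coact_coinv_proj m :
  coact M a b (coinv_proj (a * b)%g m) = coinv_proj a m ⊗ aone (H b).
Proof.
(* Both sides have the same convolution with the identity, and [deconv] recovers them from it. *)
have cK := convK (M := M) tens_actM tens_act1.
rewrite -[RHS](cK coinv_proj1) -[LHS](cK (lcomp _ _)) !deconvE.
congr (tlift _ _); elim/tens_ind: (coact_at M _ m) => [|t t' IHt IHt'|n h].
- by rewrite !raddf0.
- by rewrite !raddfD /= IHt IHt'.
by rewrite !tmapE conv_coinv_proj1 conv_coact_coinv_proj.
Qed.

End TensorModule.

Lemma coinv_proj_family m : coinvariant_family (fun a => coinv_proj a m).
Proof. by move=> a b; exact: coact_coinv_proj. Qed.

(** * The isomorphism and its inverse *)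

Let coM := subpicomodule_picomodule (coinvariants M).

Lemma coinv_proj_in a m : coinv_proj a m \in coinvariants M a.
Proof.
by apply/asboolP; exists (coinv_proj^~ m) => //; exact: coinv_proj_family.
Qed.

Definition to_coinv a (m : M 1%g) : coM a :=
  exist (fun x => is_true (x \in coinvariants M a)) _ (coinv_proj_in a m).

Lemma to_coinvE a m : subspace_val (to_coinv a m) = coinv_proj a m.
Proof. by []. Qed.

Lemma to_coinv_linear a : linear (@to_coinv a).
Proof.
move=> k x y; apply: val_inj; rewrite -![\val _]/(subspace_val _).
by rewrite linearP !to_coinvE linearP.
Qed.

HB.instance Definition _ a :=
  GRing.isLinear.Build K _ _ *:%R (@to_coinv a) (@to_coinv_linear a).

Let N := triv_hopf_picomodule coM.

Definition to_triv a : {linear M a -> N a} :=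
  lcomp (tmap (@to_coinv a) (@idfun (H a))) (coact_at M (mul1g a)).

Lemma to_trivE a (m : M a) :
  to_triv a m = tmap (@to_coinv a) (@idfun (H a)) (coact_at M (mul1g a) m).
Proof. by []. Qed.

Definition coinv_act a (n : coM a) (h : H a) : M a := ract M a (subspace_val n) h.

Lemma coinv_act_bilinear a : bilinear_for *:%R *:%R (@coinv_act a).
Proof.
by split=> [h|n] k u v /=; rewrite /coinv_act ?linearPr // linearP linearPl.
Qed.

HB.instance Definition _ a := bilinear_isBilinear.Build K _ _ _ *:%R *:%R
  (@coinv_act a) (@coinv_act_bilinear a).

Definition of_triv a : {linear N a -> M a} := tlift (@coinv_act a).

Lemma of_trivE a (n : coM a) h :
  of_triv a (n ⊗ h) = ract M a (subspace_val n) h.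
Proof. exact: tliftbE. Qed.

Lemma to_trivK a : cancel (to_triv a) (of_triv a).
Proof.
move=> m; rewrite -[RHS]coinv_projK.
rewrite to_trivE.
elim/tens_ind: (coact_at M (mul1g a) m) => [|t t' IHt IHt'|n h].
- by rewrite !raddf0.
- by rewrite !raddfD /= IHt IHt'.
by rewrite !tmapE [LHS]of_trivE tliftbE.
Qed.

(** Coinvariance sends [m 1] to [m a (x) 1], so the left side is [m a] acted on by
    [sum h_(1) S(h_(2))]. *)
Lemma coinv_proj_ract a (m : forall c, M c) h : coinvariant_family m ->
  coinv_proj a (ract M 1%g (m 1%g) h) = (counit H h : K) *: m a.
Proof.
move=> mP; rewrite /coinv_proj deconvE coact_at_ract (coinvariant_family_at _ mP).
rewrite -[in RHS](ract1 (m a)) -linearZr_LR -antipodeV_mulr.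
elim/tens_ind: (comul_at H (mulgV a) h) => [|t t' IHt IHt'|x y].
- by rewrite !(raddf0, linear0r).
- by rewrite !(linearDr, raddfD) /= IHt IHt'.
by rewrite tmap2E !tmapE !tliftbE ractM /= amul1x.
Qed.

Lemma of_trivK a : cancel (of_triv a) (to_triv a).
Proof.
move=> t; elim/tens_ind: t => [|t t' IHt IHt'|n h]; first by rewrite !raddf0.
  rewrite (linearD (of_triv a)) (linearD (to_triv a)).
  by rewrite [X in X + _]IHt [X in _ + X]IHt'.
(* A whole coinvariant family passes through [n]; its component in [M 1] is the one that [to_coinv]
   can take. *)
have /asboolP[m mP mE] : subspace_val n \in coinvariants M a := valP n.
have to_coinv_ract x :
    to_coinv a (ract M 1%g (m 1%g) x) = (counit H x : K) *: n.
  apply: val_inj; rewrite -![\val _]/(subspace_val _) to_coinvE.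
  by rewrite coinv_proj_ract // mE linearZ.
rewrite of_trivE -mE.
rewrite to_trivE coact_at_ract (coinvariant_family_at _ mP).
rewrite -[h in RHS]comul_at_counitl.
elim/tens_ind: (comul_at H (mul1g a) h) => [|s s' IHs IHs'|x y].
- by rewrite !(linear0r, raddf0).
- by rewrite !(linearDr, raddfD) /= IHs IHs'.
rewrite tmap2E !tmapE tunitlE linearZr_LR -linearZl_LR -to_coinv_ract.
by rewrite /= amul1x.
Qed.

Lemma of_triv_hom : hopf_picomodule_hom of_triv.
Proof.
split=> [a b t|a t x]; last first.
  elim/tens_ind: t => [|t t' IHt IHt'|n h]; first by rewrite !(linear0l, raddf0).
    by rewrite !(linearDl, raddfD) /= IHt IHt'.
  by rewrite [ract N a _ x]triv_actE !of_trivE ractM.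
elim/tens_ind: t => [|t t' IHt IHt'|n h]; first by rewrite !raddf0.
  by rewrite !raddfD /= IHt IHt'.
rewrite of_trivE coact_ract [coact N a b _]triv_coactE.
(* The coaction of [M] on [n] is the image of the restricted one, so both sides are expressed
   through [sub_coact n]. *)
rewrite -[coact M a b _](sub_coactE (N := coinvariants M)).
rewrite -[coact coM a b n]/(sub_coact n).
elim/tens_ind: (sub_coact n) => [|s s' IHs IHs'|n0 n1].
- by rewrite !(linear0l, raddf0).
- by rewrite !(linearDl, raddfD) /= IHs IHs'.
elim/tens_ind: (comul H a b h) => [|s s' IHs IHs'|x y].
- by rewrite !(linear0r, raddf0).
- by rewrite !(linearDr, raddfD) /= IHs IHs'.
by rewrite !(tmapE, tmap2E) of_trivE.
Qed.

End FundamentalTheorem.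

Theorem theorem2 (K : fieldType) (G : groupType) (H : hopf_picoalgebra K G)
    (M : hopf_picomodule H) :
  hopf_picomodule_iso M
    (triv_hopf_picomodule (subpicomodule_picomodule (coinvariants M))).
Proof.
exists (to_triv M), (of_triv M); split.
- exact: hopf_picomodule_hom_inv (@to_trivK _ _ _ M) (@of_trivK _ _ _ M)
    (@of_triv_hom _ _ _ M).
- exact: of_triv_hom.
- exact: to_trivK.
- exact: of_trivK.
Qed.
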